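(* Let $(M,G=g+F)$ be a generalized Riemannian manifold with fundamental 2-form $F$ and associated $(1,1)$-tensor $A$ (so $g(AX,Y)=F(X,Y)$). Let $\nabla$ be an Einstein's connection on $(M,G)$ whose torsion $(0,3)$-tensor $T$ is totally skew-symmetric. Then $\nabla$ satisfies the $A$-torsion condition $T(AX,Y)=T(X,AY)$ (for all $X,Y\in\mathfrak X_M$) if and only if $\nabla$ preserves the symmetric part of $G$, i.e. $\nabla g=0$. In this case, for all vector fields $X,Y,Z$: (i) $(\nabla^g_XA)Y=-T(X,Y)$, i.e. $\nabla^gA=-T$; (ii) $N_A(X,Y,Z)=\frac43\,dF(X,Y,AZ)$.
   Context: A generalized Riemannian manifold $(M,G=g+F)$ is a smooth manifold $M$ with a $(0,2)$-tensor $G$ whose symmetric part $g$ is non-degenerate (of arbitrary signature) and whose skew-symmetric part $F\neq 0$ (the fundamental 2-form) has constant rank. The $(1,1)$-tensor $A$ is defined by $g(AX,Y)=F(X,Y)$; it is $g$-skew-symmetric. $\mathfrak X_M$ is the set of smooth vector fields on $M$, and $\nabla^g$ is the Levi-Civita connection of $g$. For a linear connection $\nabla$, the torsion is $T(X,Y)=\nabla_XY-\nabla_YX-[X,Y]$ and $T(X,Y,Z):=g(T(X,Y),Z)$. An Einstein's connection is a linear connection $\nabla$ satisfying the Einstein metricity condition $XG(Y,Z)-G(\nabla_YX,Z)-G(Y,\nabla_XZ)=0$ for commuting vector fields $X,Y$ ($[X,Y]=0$); equivalently, $(\nabla_XG)(Y,Z)=-G(T(X,Y),Z)$ for all $X,Y,Z$.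 The torsion is totally skew-symmetric if $T(X,Y,Z)$ is skew-symmetric in all arguments. The Nijenhuis tensor is $N_A(X,Y)=[AX,AY]+A^2[X,Y]-A[AX,Y]-A[X,AY]$, with $N_A(X,Y,Z):=g(N_A(X,Y),Z)$. The exterior derivative is normalized without the factor $\frac13$: for pairwise commuting vector fields, $dF(X,Y,Z)=X(F(Y,Z))+Y(F(Z,X))+Z(F(X,Y))$. *)

(* Defs.v *)
From HB Require Import structures.
From mathcomp Require Import all_boot all_order all_algebra.
From mathcomp Require Import all_classical all_reals.
From mathcomp Require Import topology normedtype derive.
From mathcomp Require Import ring.

Set Implicit Arguments.
Unset Strict Implicit.
Unset Printing Implicit Defensive.

Import GRing.Theory Num.Theory.
Import numFieldNormedType.Exports.

Local Open Scope classical_set_scope.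
Local Open Scope ring_scope.

Section SmoothMaps.
Context (R : realType) (V : normedModType R).

(* Only meaningful when U is open: the iterated directional derivatives of f of
   order at most k exist and are continuous on U. *)
Fixpoint Ck_on (W : normedModType R) (k : nat) (U : set V) (f : V -> W) : Prop :=
  (forall x, U x -> {for x, continuous f}) /\
  if k is k'.+1 then
    forall v, (forall x, U x -> derivable f x v) /\ Ck_on k' U ('D_v f)
  else True.

Definition smooth_on (W : normedModType R) (U : set V) (f : V -> W) : Prop :=
  forall k, Ck_on k U f.

Lemma Ck_on_ext (W : normedModType R) k (U : set V) (f g : V -> W) :
  open U -> (forall x, U x -> f x = g x) -> Ck_on k U f -> Ck_on k U g.
Proof.
move=> oU; elim: k f g => [|k IH] f g fg /= [cf df].
all: have fgn x : U x -> \forall y \near x, f y = g y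
  by move=> Ux; near=> y; apply: fg; near: y; exact: open_nbhs_nbhs.
all: have cg : forall x, U x -> {for x, continuous g}.
1,3: move=> x Ux; rewrite /prop_for /continuous_at -(fg _ Ux).
1,2: exact: (cvg_trans (near_eq_cvg (fgn x Ux)) (cf x Ux)).
  by split.
split=> // v; have [dfv Cf] := df v; split.
  by move=> x Ux; apply: near_eq_derivable (fgn x Ux) (dfv x Ux).
apply: IH Cf => x Ux; exact: (near_eq_derive _ (fgn x Ux)).
Unshelve. all: by end_near. Qed.

Lemma Ck_on_le (W : normedModType R) k (U : set V) (f : V -> W) :
  Ck_on k.+1 U f -> Ck_on k U f.
Proof.
elim: k f => [|k IH] f [cf df]; first by split.
split=> // v; have [dfv Cf] := df v; split=> //; exact: IH.
Qed.

Lemma Ck_on_cst (W : normedModType R) k (U : set V) (w : W) :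
  Ck_on k U (cst w).
Proof.
elim: k w => [|k IH] w /=; split=> //; try by move=> x _; exact: cst_continuous.
move=> v; split; first by move=> x _; exact: derivable_cst.
rewrite (_ : 'D_v (cst w) = cst 0) //.
by apply/funext => x; rewrite derive_cst.
Qed.

Lemma Ck_onB (W : normedModType R) k (U : set V) (f g : V -> W) :
  open U -> Ck_on k U f -> Ck_on k U g -> Ck_on k U (f - g).
Proof.
move=> oU; elim: k f g => [|k IH] f g /= [cf df] [cg dg].
all: split; first by move=> x Ux; apply: continuousB; [exact: cf|exact: cg].
  by [].
move=> v; have [[dfv Cf] [dgv Cg]] := (df v, dg v); split.
  by move=> x Ux; apply: derivableB; [exact: dfv|exact: dgv].
apply: Ck_on_ext (IH _ _ Cf Cg) => // x Ux.
by rewrite deriveB; [|exact: dfv|exact: dgv].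
Qed.

Lemma Ck_onD (W : normedModType R) k (U : set V) (f g : V -> W) :
  open U -> Ck_on k U f -> Ck_on k U g -> Ck_on k U (f + g).
Proof.
move=> oU Cf Cg; rewrite -[g]opprK -[- g]sub0r.
by do 2![apply: Ck_onB => //]; exact: Ck_on_cst.
Qed.

Lemma Ck_onM k (U : set V) (f g : V -> R) :
  open U -> Ck_on k U f -> Ck_on k U g -> Ck_on k U (f * g).
Proof.
move=> oU; elim: k f g => [|k IH] f g.
  move=> [cf _] [cg _]; split=> // x Ux.
  by apply: continuousM; [exact: cf|exact: cg].
move=> Cf Cg; have [Cf' Cg'] := (Ck_on_le Cf, Ck_on_le Cg).
case: Cf Cg => cf df [cg dg]; split.
  by move=> x Ux; apply: continuousM; [exact: cf|exact: cg].
move=> v; have [[dfv Dfv] [dgv Dgv]] := (df v, dg v); split.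
  by move=> x Ux; apply: derivableM; [exact: dfv|exact: dgv].
apply: Ck_on_ext (Ck_onD oU (IH _ _ Cf' Dgv) (IH _ _ Cg' Dfv)) => // x Ux.
by rewrite deriveM; [|exact: dfv|exact: dgv].
Qed.

End SmoothMaps.

Record chart (R : realType) (n : nat) (M : topologicalType) := Chart {
  chart_dom : set M;
  chart_cod : set 'rV[R]_n;
  chart_fun :> M -> 'rV[R]_n;
  chart_inv : 'rV[R]_n -> M;
  open_chart_dom : open chart_dom;
  open_chart_cod : open chart_cod;
  chart_funS : forall p, chart_dom p -> chart_cod (chart_fun p);
  chart_invS : forall x, chart_cod x -> chart_dom (chart_inv x);
  chart_funK : forall p, chart_dom p -> chart_inv (chart_fun p) = p;
  chart_invK : forall x, chart_cod x -> chart_fun (chart_inv x) = x;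
  chart_fun_continuous : forall p, chart_dom p -> {for p, continuous chart_fun};
  chart_inv_continuous : forall x, chart_cod x -> {for x, continuous chart_inv}
}.

Record smoothManifold (R : realType) (n : nat) := SmoothManifold {
  carrier :> topologicalType;
  manifold_hausdorff : hausdorff_space carrier;
  manifold_second_countable : @second_countable carrier;
  atlas : set (chart R n carrier);
  atlas_cover : forall p, exists2 c, atlas c & chart_dom c p;
  atlas_compat : forall c c', atlas c -> atlas c' ->
    smooth_on (chart_cod c `&` chart_inv c @^-1` chart_dom c')
              (c' \o chart_inv c)
}.

Section SmoothFunctions.
Context (R : realType) (n : nat) (M : smoothManifold R n).

Definition smooth_fun : {pred (M -> R)} := [pred f : M -> R |
  `[< forall c, atlas c -> smooth_on (chart_cod c) (f \o chart_inv c) >]].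

Lemma smooth_fun_subring : subring_closed smooth_fun.
Proof.
split.
- by apply/asboolP => c _ k; exact: (Ck_on_cst k (chart_cod c) (1 : R)).
- move=> f g /asboolP sf /asboolP sg; apply/asboolP => c ac k.
  rewrite (_ : _ \o _ = (f \o chart_inv c) - (g \o chart_inv c)) //.
  by apply: Ck_onB; [exact: open_chart_cod|exact: sf|exact: sg].
- move=> f g /asboolP sf /asboolP sg; apply/asboolP => c ac k.
  rewrite (_ : _ \o _ = (f \o chart_inv c) * (g \o chart_inv c)) //.
  by apply: Ck_onM; [exact: open_chart_cod|exact: sf|exact: sg].
Qed.

HB.instance Definition _ :=
  GRing.isSubringClosed.Build (M -> R) smooth_fun smooth_fun_subring.

Lemma smooth_fun_scaler (a : R) (f : M -> R) :
  f \in smooth_fun -> a *: f \in smooth_fun.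
Proof.
move=> sf; rewrite (_ : a *: f = cst a * f); last by apply/funext.
rewrite rpredM //; apply/asboolP => c _ k.
exact: (Ck_on_cst k (chart_cod c) a).
Qed.

HB.instance Definition _ :=
  GRing.isScaleClosed.Build R (M -> R) smooth_fun smooth_fun_scaler.

Record Cinfty := MkCinfty { Cinfty_fun :> M -> R; _ : Cinfty_fun \in smooth_fun }.

HB.instance Definition _ := [isSub for Cinfty_fun].
HB.instance Definition _ := [Choice of Cinfty by <:].
HB.instance Definition _ := 
  GRing.SubChoice_isSubComPzRing.Build _ _ Cinfty (GRing.subringClosedP _).
HB.instance Definition _ := 
  GRing.SubZmodule_isSubLmodule.Build _ _ _ Cinfty
    (GRing.subsemimodClosedP smooth_fun).

Lemma CinftyP (f g : Cinfty) : (forall p, f p = g p) -> f = g.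
Proof. by move=> fg; apply/val_inj/funext. Qed.

End SmoothFunctions.

Lemma Cinfty_scalerAl (R : realType) (n : nat) (M : smoothManifold R n)
  (a : R) (f g : Cinfty M) : a *: (f * g) = a *: f * g.
Proof. by apply: CinftyP => p; exact: mulrA. Qed.

Section VectorFields.
Context (R : realType) (n : nat) (M : smoothManifold R n).

Definition derivation : {pred (Cinfty M -> (Cinfty M)^o)} :=
  [pred X : Cinfty M -> (Cinfty M)^o |
    `[< (forall (a : R) (f g : Cinfty M),
           X (a *: f + g) = a *: (X f : Cinfty M) + X g) /\
        (forall f g : Cinfty M, X (f * g) = X f * g + f * X g) >]].

Lemma derivation_submod : submod_closed derivation.
Proof.
split.
  apply/asboolP; split=> [a f g|f g].
    by rewrite /= scaler0 addr0.
  by rewrite /= mul0r mulr0 addr0.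
move=> h X Y /asboolP[Xl Xd] /asboolP[Yl Yd]; apply/asboolP.
have E f : (h *: X + Y) f = h * (X f : Cinfty M) + (Y f : Cinfty M) by [].
split=> [a f g|f g]; rewrite !E.
  rewrite Xl Yl mulrDr scalerDr.
  have -> : h * (a *: (X f : Cinfty M)) = a *: (h * (X f : Cinfty M)).
    by rewrite mulrC -Cinfty_scalerAl mulrC.
  by rewrite addrACA.
by rewrite Xd Yd; ring.
Qed.

HB.instance Definition _ :=
  GRing.isSubmodClosed.Build (Cinfty M) (Cinfty M -> (Cinfty M)^o)
    derivation derivation_submod.

(* Smooth vector fields on M, as derivations of the algebra of smooth
   functions; they form a module over that algebra. *)
Record vfield := MkVfield {
  vfield_fun :> Cinfty M -> (Cinfty M)^o;
  _ : vfield_fun \in derivation }.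

HB.instance Definition _ := [isSub for vfield_fun].
HB.instance Definition _ := [Choice of vfield by <:].
HB.instance Definition _ := [SubChoice_isSubLmodule of vfield by <:].

Lemma vfieldP (X Y : vfield) : (forall f : Cinfty M, X f = Y f) -> X = Y.
Proof. by move=> XY; apply/val_inj/funext. Qed.

Lemma vfield_linear (X : vfield) (a : R) (f g : Cinfty M) :
  X (a *: f + g) = a *: (X f : Cinfty M) + X g.
Proof. by case: X => X /= /asboolP[]. Qed.

Lemma vfieldM (X : vfield) (f g : Cinfty M) : X (f * g) = X f * g + f * X g.
Proof. by case: X => X /= /asboolP[]. Qed.

Lemma vfieldD (X : vfield) (f g : Cinfty M) : X (f + g) = X f + X g.
Proof. by rewrite -[f in LHS]scale1r vfield_linear scale1r. Qed.

Lemma vfieldZ (X : vfield) (a : R) (f : Cinfty M) :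
  X (a *: f) = a *: (X f : Cinfty M).
Proof.
have X0 : X 0 = 0 by apply: (addrI (X 0)); rewrite -vfieldD !addr0.
by rewrite -[a *: f]addr0 vfield_linear X0 addr0.
Qed.

Lemma bracket_subproof (X Y : vfield) :
  (fun f : Cinfty M => X (Y f) - Y (X f)) \in derivation.
Proof.
apply/asboolP; split=> [a f g|f g].
  rewrite !vfield_linear scalerBr opprD; exact: addrACA.
rewrite !vfieldM !vfieldD !vfieldM.
set Xf : Cinfty M := X f; set Xg : Cinfty M := X g.
set Yf : Cinfty M := Y f; set Yg : Cinfty M := Y g.
by ring.
Qed.

Definition bracket (X Y : vfield) : vfield := MkVfield (bracket_subproof X Y).

Definition independent_at (p : M) (m : nat) (E : 'I_m -> vfield) : Prop :=
  forall c : 'I_m -> R,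
    (forall f : Cinfty M, \sum_(i < m) c i * (E i f : Cinfty M) p = 0) ->
    forall i, c i = 0.

End VectorFields.

Section Tensors.
Context (R : realType) (n : nat) (M : smoothManifold R n).

Record tensor02 := Tensor02 {
  tensor02_fun :> vfield M -> vfield M -> Cinfty M;
  tensor02_linearl : forall (f : Cinfty M) X X' Y,
    tensor02_fun (f *: X + X') Y = f * tensor02_fun X Y + tensor02_fun X' Y;
  tensor02_linearr : forall (f : Cinfty M) X Y Y',
    tensor02_fun X (f *: Y + Y') = f * tensor02_fun X Y + tensor02_fun X Y' }.

Implicit Types (B : tensor02) (X Y Z : vfield M).

Lemma symt_subproof B :
  (forall (f : Cinfty M) X X' Y,
     2^-1 *: (B (f *: X + X') Y + B Y (f *: X + X')) =
     f * (2^-1 *: (B X Y + B Y X)) + 2^-1 *: (B X' Y + B Y X')) *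
  (forall (f : Cinfty M) X X' Y,
     2^-1 *: (B (f *: X + X') Y - B Y (f *: X + X')) =
     f * (2^-1 *: (B X Y - B Y X)) + 2^-1 *: (B X' Y - B Y X')).
Proof.
split=> f X X' Y; rewrite tensor02_linearl tensor02_linearr.
all: rewrite [f * (_ *: _)]mulrC -Cinfty_scalerAl -scalerDr; congr (_ *: _).
all: by ring.
Qed.

Lemma sym_part_subproof B (f : Cinfty M) X Y Y' :
  2^-1 *: (B X (f *: Y + Y') + B (f *: Y + Y') X) =
  f * (2^-1 *: (B X Y + B Y X)) + 2^-1 *: (B X Y' + B Y' X).
Proof.
by rewrite addrC (symt_subproof B).1 [B Y X + _]addrC [B Y' X + _]addrC.
Qed.

Lemma skew_part_subproof B (f : Cinfty M) X Y Y' :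
  2^-1 *: (B X (f *: Y + Y') - B (f *: Y + Y') X) =
  f * (2^-1 *: (B X Y - B Y X)) + 2^-1 *: (B X Y' - B Y' X).
Proof.
have sw U V : 2^-1 *: (B U V - B V U) = - (2^-1 *: (B V U - B U V)).
  by rewrite -scalerN opprB.
by rewrite sw (symt_subproof B).2 [_ *: (B X Y - _)]sw [_ *: (B X Y' - _)]sw
  opprD mulrN.
Qed.

Definition sym_part B : tensor02 :=
  Tensor02 (tensor02_fun := fun X Y => 2^-1 *: (B X Y + B Y X))
    (symt_subproof B).1 (sym_part_subproof B).

Definition skew_part B : tensor02 :=
  Tensor02 (tensor02_fun := fun X Y => 2^-1 *: (B X Y - B Y X))
    (symt_subproof B).2 (skew_part_subproof B).

(* Every tangent vector at p is the value at p of a vector field X, and X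
   vanishes at p iff all its derivatives X f do. *)
Definition nondegenerate B : Prop :=
  forall (p : M) X, (forall Y, B X Y p = 0) ->
    forall f : Cinfty M, (X f : Cinfty M) p = 0.

(* dim M = n, so n vector fields independent at p form a basis of the tangent
   space there, and the rank of B at p is that of its Gram matrix. *)
Definition constant_rank B : Prop :=
  exists r : nat, forall p : M, exists2 E : 'I_n -> vfield M,
    independent_at p E & \rank (\matrix_(i < n, j < n) B (E i) (E j) p) = r.

Record generalizedRiemannian := GeneralizedRiemannian {
  gR_tensor :> tensor02;
  gR_nondegenerate : nondegenerate (sym_part gR_tensor);
  gR_skew_neq0 : exists X Y, skew_part gR_tensor X Y <> 0;
  gR_constant_rank : constant_rank (skew_part gR_tensor) }.

(* Normalized without the factor 1/3; on pairwise commuting fields this is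
   X(B(Y, Z)) + Y(B(Z, X)) + Z(B(X, Y)). *)
Definition dform2 B X Y Z : Cinfty M :=
  (X (B Y Z) : Cinfty M) + Y (B Z X) + Z (B X Y)
  - B (bracket X Y) Z - B (bracket Y Z) X - B (bracket Z X) Y.

Definition nijenhuis (A : vfield M -> vfield M) X Y : vfield M :=
  bracket (A X) (A Y) + A (A (bracket X Y))
  - A (bracket (A X) Y) - A (bracket X (A Y)).

End Tensors.

Section Connections.
Context (R : realType) (n : nat) (M : smoothManifold R n).

Record connection := Connection {
  connection_fun :> vfield M -> vfield M -> vfield M;
  connection_linearl : forall (f : Cinfty M) X X' Y,
    connection_fun (f *: X + X') Y
    = f *: connection_fun X Y + connection_fun X' Y;
  connectionD : forall X Y Y',
    connection_fun X (Y + Y') = connection_fun X Y + connection_fun X Y';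
  connection_leibniz : forall X (f : Cinfty M) Y,
    connection_fun X (f *: Y)
    = (X f : Cinfty M) *: Y + f *: connection_fun X Y }.

Implicit Types (D : connection) (B : tensor02 M) (X Y Z : vfield M).

Definition torsion D X Y : vfield M := D X Y - D Y X - bracket X Y.

(* (D_X B)(Y, Z) *)
Definition nabla02 D B X Y Z : Cinfty M :=
  (X (B Y Z) : Cinfty M) - B (D X Y) Z - B Y (D X Z).

(* (D_X A) Y *)
Definition nabla11 D (A : vfield M -> vfield M) X Y : vfield M :=
  D X (A Y) - A (D X Y).

Definition parallel02 D B : Prop := forall X Y Z, nabla02 D B X Y Z = 0.

Definition levi_civita B D : Prop :=
  (forall X Y, torsion D X Y = 0) /\ parallel02 D B.

(* (D_X G)(Y, Z) = - G(T(X, Y), Z). For commuting X and Y this reads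
   X G(Y, Z) - G(D_Y X, Z) - G(Y, D_X Z) = 0, see einstein_commuting. *)
Definition einstein (G : tensor02 M) D : Prop :=
  forall X Y Z, nabla02 D G X Y Z = - G (torsion D X Y) Z.

Lemma einstein_commuting (G : tensor02 M) D X Y Z :
  einstein G D -> bracket X Y = 0 ->
  (X (G Y Z) : Cinfty M) - G (D Y X) Z - G Y (D X Z) = 0.
Proof.
move=> E br; have := E X Y Z; rewrite /nabla02 /torsion br subr0.
have -> : D X Y - D Y X = (-1) *: D Y X + D X Y by rewrite scaleN1r addrC.
rewrite tensor02_linearl mulN1r opprD opprK => EG.
have -> : (X (G Y Z) : Cinfty M) - G (D Y X) Z - G Y (D X Z) =
  (X (G Y Z) : Cinfty M) - G (D X Y) Z - G Y (D X Z)
  + (G (D X Y) Z - G (D Y X) Z) by ring.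
by rewrite EG; ring.
Qed.

(* Skew-symmetry of the (0,3)-tensor g(T(X,Y),Z) under two transpositions that
   generate all permutations of the arguments. *)
Definition totally_skew (g : tensor02 M) (T : vfield M -> vfield M -> vfield M) :
    Prop :=
  forall X Y Z, g (T X Y) Z = - g (T Y X) Z /\ g (T X Y) Z = - g (T X Z) Y.

End Connections.

(* Main.v *)
Require Import Defs.
From mathcomp Require Import all_boot all_order all_algebra.
From mathcomp Require Import all_classical all_reals.
From mathcomp Require Import ring.

Set Implicit Arguments.
Unset Strict Implicit.
Unset Printing Implicit Defensive.

Import GRing.Theory.

Local Open Scope ring_scope.

(** Write [g] and [F] for the symmetric and skew parts of [G], and [T] for the
    torsion of the Einstein connection [D].

    Symmetrizing the Einstein condition [(D_X G)(Y, Z) = - G(T(X, Y), Z)] in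
    [Y] and [Z] kills the [g]-term, because [T] is totally skew, and leaves
    [2 (D_X g)(Y, Z) = g(T(X, Y), A Z) + g(T(X, Z), A Y)]
    ([einstein_sym_part]). Cyclic permutation of the arguments of [T] turns
    the right-hand side into [g(T(Y, A Z) - T(A Y, Z), X)], so, [g] being
    non-degenerate, [D g = 0] is exactly the [A]-torsion condition.

    Suppose now [D g = 0]. Then [T(A X, Y) = T(X, A Y) = - A (T(X, Y))], and the
    whole Einstein condition becomes a statement about [F] alone:
    [(D_X F)(Y, Z) = - G(T(X, Y), Z)], or equivalently
    [(D_X A) Y = - T(X, Y) - A (T(X, Y))]. A metric connection with totally
    skew torsion is [D^g + T/2] ([levi_civita_contorsion]), and the half
    torsion terms in [D^g A] cancel [- A T]; this is (i). For (ii), [dF] and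
    [N_A] are both expressed through [D] and [T] ([dform2_connection],
    [nijenhuis_connection]), giving [dF = - 3 T] and [N_A = 4 A T]; moving [A]
    to the third argument of [g] yields the factor 4/3. *)

(** * Additivity and cancellation of a factor two *)

Section Algebra.
Context {R : realType} {n : nat} {M : smoothManifold R n}.
Implicit Types (B : tensor02 M) (X Y Z : vfield M) (f h : Cinfty M).

Lemma tensor02Dl B X X' Y : B (X + X') Y = B X Y + B X' Y.
Proof. by rewrite -{1}[X]scale1r tensor02_linearl mul1r. Qed.

Lemma tensor02Nl B X Y : B (- X) Y = - B X Y.
Proof.
have B0 : B 0 Y = 0 by apply: (addrI (B 0 Y)); rewrite -tensor02Dl !addr0.
by apply: (addIr (B X Y)); rewrite -tensor02Dl !addNr.
Qed.

Lemma Cinfty_half2 f : 2^-1 *: (f + f) = f.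
Proof.
rewrite -mulr2n -scaler_nat scalerA -[RHS]scale1r; congr (_ *: _).
by rewrite mulVf // Num.Theory.pnatr_eq0.
Qed.

Lemma Cinfty_double_inj f h : f + f = h + h -> f = h.
Proof. by move=> fh; rewrite -[f]Cinfty_half2 fh Cinfty_half2. Qed.

(** Linear identities between vector fields are checked by applying both sides
    to a smooth function, which turns them into identities in a commutative
    ring. *)
Definition vfield_at f X : Cinfty M := X f.

Lemma vfield_atP X Y : (forall f, vfield_at f X = vfield_at f Y) -> X = Y.
Proof. exact: vfieldP. Qed.

Lemma vfield_atD f X Y : vfield_at f (X + Y) = vfield_at f X + vfield_at f Y.
Proof. by []. Qed.

Lemma vfield_atN f X : vfield_at f (- X) = - vfield_at f X.
Proof. by []. Qed.

Definition vfield_atE := (vfield_atD, vfield_atN).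

Lemma vfield_double_inj X Y : X + X = Y + Y -> X = Y.
Proof.
move=> XY; apply: vfield_atP => f; apply: Cinfty_double_inj.
by rewrite -!vfield_atD XY.
Qed.

Lemma bracketC X Y : bracket X Y = - bracket Y X.
Proof. by apply: vfieldP => f; rewrite [RHS]opprB. Qed.

Lemma sym_partC B X Y : sym_part B X Y = sym_part B Y X.
Proof. by rewrite /= addrC. Qed.

Lemma skew_partC B X Y : skew_part B X Y = - skew_part B Y X.
Proof. by rewrite /= -scalerN opprB. Qed.

Lemma sym_skewE B X Y : B X Y = sym_part B X Y + skew_part B X Y.
Proof. by rewrite /= -scalerDr addrACA subrr addr0 Cinfty_half2. Qed.

Lemma nondegenerate_inj B X Y :
  Defs.nondegenerate B -> (forall Z, B X Z = B Y Z) -> X = Y.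
Proof.
move=> ndB XY; apply: vfieldP => f; apply: CinftyP => p; apply/eqP.
rewrite -subr_eq0; apply/eqP.
suff /(ndB p (X - Y)) : forall Z, B (X - Y) Z p = 0 by exact.
by move=> Z; rewrite tensor02Dl tensor02Nl XY subrr.
Qed.

End Algebra.

(** * Connections with torsion *)

Section Torsion.
Context {R : realType} {n : nat} {M : smoothManifold R n}.
Implicit Types (B : tensor02 M) (D : connection M) (X Y Z : vfield M).

Lemma torsionC D X Y : torsion D X Y = - torsion D Y X.
Proof.
rewrite /torsion [bracket X Y]bracketC.
by apply: vfield_atP => f; rewrite !vfield_atE; ring.
Qed.

Lemma bracketE D X Y : bracket X Y = D X Y - D Y X - torsion D X Y.
Proof. by rewrite /torsion opprB addrC subrK. Qed.

Lemma nabla02_sym_skew D B X Y Z :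
  nabla02 D B X Y Z = nabla02 D (sym_part B) X Y Z
                      + nabla02 D (skew_part B) X Y Z.
Proof.
rewrite /nabla02 !(sym_skewE B) vfieldD.
set a : Cinfty M := X (sym_part B Y Z); set b : Cinfty M := X (skew_part B Y Z).
by ring.
Qed.

Lemma nabla02_sym_part D B X Y Z :
  nabla02 D (sym_part B) X Y Z + nabla02 D (sym_part B) X Y Z
  = nabla02 D B X Y Z + nabla02 D B X Z Y.
Proof.
rewrite !(nabla02_sym_skew D B) /nabla02.
rewrite (sym_partC B Z Y) (sym_partC B (D X Z)) (sym_partC B Z).
rewrite (skew_partC B Z Y) (skew_partC B (D X Z)) (skew_partC B Z).
have -> : X (- skew_part B Y Z) = - (X (skew_part B Y Z) : Cinfty M).
  by rewrite -scaleN1r vfieldZ scaleN1r.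
set a : Cinfty M := X (sym_part B Y Z); set b : Cinfty M := X (skew_part B Y Z).
by ring.
Qed.

(** In the defining formula of [dform2] each derivative [X (B(Y, Z))] is
    expanded by the Leibniz rule and each bracket by the torsion; the covariant
    derivatives of the arguments then cancel in pairs, so that the torsion is
    all that survives of the connection besides [D B]. *)
Lemma dform2_connection D B X Y Z :
  (forall U V, B U V = - B V U) ->
  dform2 B X Y Z =
    (nabla02 D B X Y Z + nabla02 D B Y Z X + nabla02 D B Z X Y)
    + (B (torsion D X Y) Z + B (torsion D Y Z) X + B (torsion D Z X) Y).
Proof.
move=> Bskew; rewrite /dform2 /nabla02 !(bracketE D).
(* Abstracting the torsion keeps additivity from splitting the difference that
   defines it. *)
move: (torsion D X Y) (torsion D Y Z) (torsion D Z X) => Txy Tyz Tzx.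
rewrite !tensor02Dl !tensor02Nl.
rewrite (Bskew Y (D X Z)) (Bskew Z (D Y X)) (Bskew X (D Z Y)).
set a : Cinfty M := X (B Y Z); set b : Cinfty M := Y (B Z X).
set c : Cinfty M := Z (B X Y).
by ring.
Qed.

(** The counterpart of [dform2_connection] for [nijenhuis]: in addition to
    [D A] there is a torsion contribution, minus the expression obtained from
    the Nijenhuis tensor on replacing the bracket by the torsion. *)
Lemma nijenhuis_connection D (A : {linear vfield M -> vfield M}) X Y :
  nijenhuis A X Y =
    (nabla11 D A (A X) Y - nabla11 D A (A Y) X
     - A (nabla11 D A X Y) + A (nabla11 D A Y X))
    - (torsion D (A X) (A Y) + A (A (torsion D X Y))
       - A (torsion D (A X) Y) - A (torsion D X (A Y))).
Proof.
rewrite /nijenhuis !(bracketE D) /nabla11 !raddfB /=.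
apply: vfield_atP => f; rewrite !vfield_atE; ring.
Qed.

(** Koszul's argument for the difference [S = D - Dg], which satisfies
    [S(X, Y) - S(Y, X) = T(X, Y)] and [g(S(X, Y), Z) = - g(Y, S(X, Z))]:
    cycling through the arguments gives
    [2 g(S(X, Y), Z) = g(T(X, Y), Z) - g(T(Y, Z), X) + g(T(Z, X), Y)], and for
    totally skew [T] the last two terms cancel. *)
Lemma levi_civita_contorsion (g : tensor02 M) (D Dg : connection M) X Y :
  Defs.nondegenerate g -> (forall U V, g U V = g V U) ->
  levi_civita g Dg -> parallel02 D g -> totally_skew g (torsion D) ->
  D X Y + D X Y = Dg X Y + Dg X Y + torsion D X Y.
Proof.
move=> ndg gC [Dg0 Dgg] Dg' Tsk; apply: (nondegenerate_inj ndg) => Z.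
have metric U V W : g (D U V) W + g V (D U W) = g (Dg U V) W + g V (Dg U W).
  have := Dg' U V W; rewrite -(Dgg U V W) /nabla02 -!addrA => /addrI.
  by rewrite -!opprD => /oppr_inj.
have tors U V W : g (torsion D U V) W
    = g (D U V) W - g (D V U) W - g (Dg U V) W + g (Dg V U) W.
  have -> : torsion D U V = D U V - D V U - Dg U V + Dg V U.
    have : torsion D U V = torsion D U V - torsion Dg U V by rewrite Dg0 subr0.
    by move=> ->; apply: vfield_atP => f; rewrite /torsion !vfield_atE; ring.
  by rewrite !tensor02Dl !tensor02Nl.
have cyc : g (torsion D Y Z) X = g (torsion D Z X) Y.
  by rewrite (Tsk Y Z X).1 (Tsk Z Y X).2 opprK.
have gTE : g (torsion D X Y) Z
    = g (torsion D X Y) Z - g (torsion D Y Z) X + g (torsion D Z X) Y.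
  by rewrite cyc subrK.
rewrite 3!tensor02Dl gTE !tors.
(* The goal contains both [D]-terms of each metricity identity; one of each
   pair is eliminated. *)
have m1 : g (D X Z) Y = g (Dg X Y) Z + g (Dg X Z) Y - g (D X Y) Z.
  by rewrite [in RHS](gC (Dg X Z)) -metric (gC Y) addrC addKr.
have m2 : g (D Y Z) X = g (Dg Y X) Z + g (Dg Y Z) X - g (D Y X) Z.
  by rewrite [in RHS](gC (Dg Y Z)) -metric (gC X) addrC addKr.
have m3 : g (D Z Y) X = g (Dg Z X) Y + g (Dg Z Y) X - g (D Z X) Y.
  by rewrite [in RHS](gC (Dg Z Y)) -metric (gC X) addrC addKr.
by rewrite m1 m2 m3; ring.
Qed.

End Torsion.

(** * Einstein connections with totally skew torsion *)

Section Einstein.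
Context {R : realType} {n : nat} {M : smoothManifold R n}.
Context {G : generalizedRiemannian M} {A : {linear vfield M -> vfield M}}.
Context {D : connection M}.
Hypothesis AE : forall X Y, sym_part G (A X) Y = skew_part G X Y.
Hypothesis einsteinD : einstein G D.
Hypothesis Tskew : totally_skew (sym_part G) (torsion D).

Local Notation g := (sym_part G).
Local Notation F := (skew_part G).
Local Notation T := (torsion D).
Implicit Types X Y Z : vfield M.

Let ndg : Defs.nondegenerate g := gR_nondegenerate (g := G).

Lemma A_skew X Y : g (A X) Y = - g X (A Y).
Proof. by rewrite AE skew_partC -AE sym_partC. Qed.

Lemma torsion_cycle X Y Z : g (T X Y) Z = g (T Y Z) X.
Proof. by rewrite (Tskew X Y Z).1 (Tskew Y X Z).2 opprK. Qed.

(** The part of the right-hand side of the Einstein condition involving [g] is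
    skew in [Y] and [Z], so symmetrization leaves only the part involving
    [F]. *)
Lemma einstein_sym_part X Y Z :
  nabla02 D g X Y Z + nabla02 D g X Y Z
  = g (T X Y) (A Z) + g (T X Z) (A Y).
Proof.
rewrite nabla02_sym_part !einsteinD !(sym_skewE G) -!AE !A_skew.
by rewrite (Tskew X Y Z).2; ring.
Qed.

(** Total skewness moves [X] into the last argument of [g] in both terms of
    [einstein_sym_part], so that [D_X g] measures the failure of the
    [A]-torsion condition against [X]; non-degeneracy then removes [X]. *)
Lemma A_torsion_iff_parallel :
  (forall X Y, T (A X) Y = T X (A Y)) <-> parallel02 D g.
Proof.
have defect X Y Z : nabla02 D g X Y Z + nabla02 D g X Y Z
    = g (T Y (A Z)) X - g (T (A Y) Z) X.
  rewrite einstein_sym_part [g (T X Y) _]torsion_cycle.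
  by rewrite [g (T X Z) _]torsion_cycle (torsionC D Z) tensor02Nl.
split=> [AT X Y Z|par X Y].
  by apply: Cinfty_double_inj; rewrite defect AT subrr addr0.
apply: (nondegenerate_inj ndg) => Z; apply/eqP.
by rewrite eq_sym -subr_eq0 -defect par addr0.
Qed.

Hypothesis par : parallel02 D g.

Lemma nabla_skew_part X Y Z : nabla02 D F X Y Z = - G (T X Y) Z.
Proof. by rewrite -einsteinD (nabla02_sym_skew D G) par add0r. Qed.

(** [nabla_skew_part] with [F(Y, Z)] written as [g(A Y, Z)]; since [D g = 0],
    the derivative passes through [g] and falls on [A] alone. *)
Lemma nabla_A X Y : nabla11 D A X Y = - (T X Y + A (T X Y)).
Proof.
apply: (nondegenerate_inj ndg) => Z.
rewrite tensor02Nl tensor02Dl (AE (T X Y)) -(sym_skewE G) -nabla_skew_part.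
have := par X (A Y) Z; rewrite /nabla02 /nabla11 tensor02Dl tensor02Nl !AE.
by move/eqP; rewrite subr_eq0 subr_eq => /eqP ->; ring.
Qed.

(** The vanishing of the right-hand side of [einstein_sym_part]: besides the
    [A]-torsion condition it says that [A] anticommutes past the torsion, which
    is how every torsion term below collapses to [A (T X Y)]. *)
Lemma torsion_Ar X Y : T X (A Y) = - A (T X Y).
Proof.
apply: (nondegenerate_inj ndg) => Z; rewrite tensor02Nl A_skew opprK.
have := einstein_sym_part X Y Z; rewrite par addr0 => /esym/eqP.
by rewrite addr_eq0 => /eqP ->; rewrite (Tskew X (A Y) Z).2.
Qed.

Lemma torsion_Al X Y : T (A X) Y = - A (T X Y).
Proof. by rewrite torsionC torsion_Ar [T Y X]torsionC opprK raddfN. Qed.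

(** Doubling avoids dividing vector fields by 2: with [2 Dg = 2 D - T],
    [2 (Dg_X A) Y = 2 (D_X A) Y - T(X, A Y) + A (T(X, Y))], and the last two
    terms add up to [2 A (T(X, Y))]. *)
Lemma nabla_levi_civita_A (Dg : connection M) X Y :
  levi_civita g Dg -> nabla11 Dg A X Y = - T X Y.
Proof.
move=> LC; have contorsion V : Dg X V + Dg X V = D X V + D X V - T X V.
  by rewrite (levi_civita_contorsion _ _ ndg (sym_partC G) LC par Tskew) addrK.
apply: vfield_double_inj.
rewrite /nabla11 addrACA -opprD -(raddfD A) !contorsion torsion_Ar.
rewrite (raddfB A _ (T X Y)) (raddfD A (D X Y)).
have /eqP := nabla_A X Y; rewrite /nabla11 subr_eq => /eqP ->.
move: (T X Y) => Txy.
by apply: vfield_atP => f; rewrite !vfield_atE; ring.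
Qed.

(** The cyclic sum of [(D_X F)(Y, Z) = - g(T(X, Y), Z) - F(T(X, Y), Z)] meets
    the torsion terms of [dform2_connection], which cancel its [F]-part; the
    remaining [g]-terms are equal by cyclicity. *)
Lemma dform2_torsion X Y Z : dform2 F X Y Z = - (g (T X Y) Z *+ 3).
Proof.
rewrite (dform2_connection D); last exact: skew_partC.
rewrite !nabla_skew_part !(sym_skewE G) -(torsion_cycle X Y Z).
by rewrite (torsion_cycle Z X Y); ring.
Qed.

Lemma nijenhuis_torsion X Y : nijenhuis A X Y = A (T X Y) *+ 4.
Proof.
rewrite (nijenhuis_connection D) !nabla_A !torsion_Ar !torsion_Al.
rewrite (torsionC D Y X); move: (T X Y) => Txy.
rewrite !(raddfN A, raddfD A).
apply: vfield_atP => f; rewrite !mulrSr mulr0n add0r !vfield_atE; ring.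
Qed.

Lemma sym_part_nijenhuis X Y Z :
  g (nijenhuis A X Y) Z = - (g (T X Y) (A Z) *+ 4).
Proof.
rewrite nijenhuis_torsion -mulNrn -A_skew; move: (A _) => V.
by rewrite !mulrSr !mulr0n !add0r !tensor02Dl.
Qed.

End Einstein.

Theorem proposition2p6 (R : realType) (n : nat) (M : smoothManifold R n)
    (G : generalizedRiemannian M) (A : {linear vfield M -> vfield M})
    (hA : forall X Y : vfield M, sym_part G (A X) Y = skew_part G X Y)
    (nabla : connection M)
    (nabla_einstein : einstein G nabla)
    (nabla_skew : totally_skew (sym_part G) (torsion nabla)) :
  ((forall X Y : vfield M, torsion nabla (A X) Y = torsion nabla X (A Y)) <->
   parallel02 nabla (sym_part G)) /\
  (parallel02 nabla (sym_part G) ->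
   (forall nablag : connection M, levi_civita (sym_part G) nablag ->
      forall X Y : vfield M, nabla11 nablag A X Y = - torsion nabla X Y) /\
   (forall X Y Z : vfield M,
      sym_part G (nijenhuis A X Y) Z =
      (4%:R / 3%:R) *: dform2 (skew_part G) X Y (A Z))).
Proof.
split; first exact: A_torsion_iff_parallel.
move=> par; split=> [nablag LC X Y|X Y Z].
  exact: nabla_levi_civita_A.
rewrite (sym_part_nijenhuis hA nabla_einstein) //.
rewrite (dform2_torsion nabla_einstein) // scalerN.
move: (sym_part G _ _) => t; rewrite -(scaler_nat 3 t) -(scaler_nat 4 t).
by rewrite scalerA divfK // Num.Theory.pnatr_eq0.
Qed.
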